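(* For every integer $k\ge 0$, $|\mathcal{U}_{2k+1}(132,4312)|=\binom{2k-1}{k}$ (with the convention $\binom{-1}{0}=1$).
   Context: West's stack-sorting map $s$ is defined recursively on finite sequences of distinct positive integers: $s$ sends the empty sequence to itself, and if $\pi$ is a nonempty such sequence with largest entry $n$, writing $\pi=LnR$ one sets $s(\pi)=s(L)s(R)n$. A permutation $\pi\in S_n$ (one-line notation) is uniquely sorted if exactly one permutation $\sigma\in S_n$ satisfies $s(\sigma)=\pi$. Let $\mathcal{U}_n$ be the set of uniquely sorted permutations in $S_n$. A permutation $\pi$ contains a pattern $\tau\in S_m$ if some subsequence of $\pi$ of length $m$ has its entries in the same relative order as $\tau$; otherwise $\pi$ avoids $\tau$. $\mathcal{U}_{n}(\tau^{(1)},\dots,\tau^{(\ell)})$ denotes the set of permutations in $\mathcal{U}_n$ avoiding all of $\tau^{(1)},\dots,\tau^{(\ell)}$. *)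

(* Defs.v *)
From HB Require Import structures.
From mathcomp Require Import all_boot all_fingroup.
Set Implicit Arguments.
Unset Strict Implicit.
Unset Printing Implicit Defensive.

(* The recursion s(L n R) = s(L) s(R) n is not structural on lists, so it is
   run with a fuel bounding the length; stack_sortE is the actual recursion. *)
Fixpoint stack_sort_rec (fuel : nat) (w : seq nat) : seq nat :=
  if fuel is fuel'.+1 then
    if w is [::] then [::] else
    let n := \max_(x <- w) x in
    let L := take (index n w) w in
    let R := drop (index n w).+1 w in
    stack_sort_rec fuel' L ++ stack_sort_rec fuel' R ++ [:: n]
  else [::].

Definition stack_sort (w : seq nat) : seq nat := stack_sort_rec (size w) w.

Lemma stack_sort_rec_size f g w :
  size w <= f -> size w <= g -> stack_sort_rec f w = stack_sort_rec g w.
Proof.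
elim: f g w => [|f IH] [|g] [|x w] //= ltwf ltwg.
set n := \max_(y <- _) y; set i := if _ then 0 else _.
have i_le : i <= size w.
  have n_in : n \in x :: w.
    rewrite /n; elim: w x {ltwf ltwg n i} => [|y w IHw] x.
      by rewrite big_seq1 inE.
    rewrite big_cons; case: (leqP x (\max_(j <- y :: w) j)) => _.
      by rewrite inE IHw orbT.
    by rewrite inE eqxx.
  by move: n_in; rewrite -index_mem.
have szL : size (take i (x :: w)) <= size w by rewrite size_take_min geq_min i_le.
have szR : size (drop i w) <= size w by rewrite size_drop leq_subr.
by rewrite (IH g _ (leq_trans szL ltwf) (leq_trans szL ltwg))
           (IH g _ (leq_trans szR ltwf) (leq_trans szR ltwg)).
Qed.

Lemma stack_sort0 : stack_sort [::] = [::].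
Proof. by []. Qed.

Lemma stack_sortE (L R : seq nat) (n : nat) :
    all (fun x => x < n) L -> all (fun x => x < n) R ->
  stack_sort (L ++ n :: R) = stack_sort L ++ stack_sort R ++ [:: n].
Proof.
move=> ltL ltR; rewrite /stack_sort size_cat /= addnS /=.
case E: (L ++ n :: R) => [|y w]; first by case: L {ltL} E.
rewrite -{}E.
have nL : n \notin L by apply/negP => /(allP ltL); rewrite ltnn.
have -> : \max_(x <- L ++ n :: R) x = n.
  apply/eqP; rewrite eqn_leq; apply/andP; split.
    apply/bigmax_leqP_seq => x; rewrite mem_cat inE.
    by case/or3P=> [/(allP ltL)/ltnW|/eqP->|/(allP ltR)/ltnW].
  by apply: (@leq_bigmax_seq _ _ _ id) => //; rewrite mem_cat inE eqxx orbT.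
rewrite index_cat (negPf nL) /= eqxx addn0 take_size_cat //.
rewrite -(cat_rcons n L R) drop_size_cat ?size_rcons //.
by congr (_ ++ (_ ++ _)); apply: stack_sort_rec_size; rewrite ?leq_addr ?leq_addl.
Qed.

(* One-line notation with entries in {1, ..., n}: 'I_n starts at 0. *)
Definition one_line (n : nat) (p : 'S_n) : seq nat := [seq (p i).+1 | i : 'I_n].

Definition uniquely_sorted (n : nat) : {set 'S_n} :=
  [set p | #|[set q : 'S_n | stack_sort (one_line q) == one_line p]| == 1].

Definition order_iso (u t : seq nat) : bool :=
  (size u == size t) &&
  [forall i : 'I_(size t), forall j : 'I_(size t),
     (nth 0 u i < nth 0 u j) == (nth 0 t i < nth 0 t j)].

(* Subsequences of w are exactly its masks; the bit mask makes the existential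
   range over a finite type. *)
Definition contains_pattern (w t : seq nat) : bool :=
  [exists m : (size w).-tuple bool, order_iso (mask m w) t].

Lemma contains_patternP (w t : seq nat) :
  reflect (exists2 u, subseq u w & order_iso u t) (contains_pattern w t).
Proof.
apply: (iffP existsP) => [[m mP]|[u /subseqP[m szm ->] uP]].
  by exists (mask m w) => //; apply: mask_subseq.
by exists (tcast szm (in_tuple m)); rewrite val_tcast.
Qed.

Definition avoids_pattern (w t : seq nat) : bool := ~~ contains_pattern w t.

Definition uniquely_sorted_avoiding (n : nat) (ts : seq (seq nat)) : {set 'S_n} :=
  [set p in uniquely_sorted n | all (avoids_pattern (one_line p)) ts].

(* Main.v *)
Require Import Defs.
From HB Require Import structures.
From mathcomp Require Import all_boot all_fingroup.
From mathcomp Require Import zify.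
Set Implicit Arguments.
Unset Strict Implicit.
Unset Printing Implicit Defensive.

(* Record a permutation by its word of ascents and descents. A sorted word is
   A B n with A and B sorted, so every suffix of its ascent word has at least as
   many ascents as descents; it has exactly one preimage iff the totals agree.
   If p is uniquely sorted and avoids 132 and 4312, then p = a R S where R < a is
   nonempty, S starts with the first entry larger than a, every entry of R is
   extremal among the entries of R up to it, and every entry of S is extremal
   among all entries up to it. Hence p is determined by its ascent word, a Dyck
   word read with descents as opening steps, together with the place where S
   starts. Such a word is sorted iff the ascent starting S comes no later than
   the first return of the Dyck word: the ascent at that return is matched with the
   descent leaving a, so its top must exceed a. Reading the words from the right,
   those with t letters, u of them ascents, are counted by a ballot recursion
   with solution (2 u - t) * 'C(t, u), which is 'C(2 k - 1, k) for t = 2 k - 1 and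
   u = k. *)

(** * Ballot words and ascent words *)

Fixpoint ballot (v : seq bool) : bool :=
  if v is _ :: v' then (count negb v <= count id v) && ballot v' else true.

Definition balanced (v : seq bool) : bool := count negb v == count id v.

Definition ascents (w : seq nat) : seq bool :=
  if w is z :: w' then pairmap ltn z w' else [::].

Lemma ballot_count v : ballot v -> count negb v <= count id v.
Proof. by case: v => //= x v /andP[]. Qed.

Lemma ballot_cat u v : ballot u -> ballot v -> ballot (u ++ v).
Proof.
move=> + bv; elim: u => //= x u IH /andP[le_x /IH ->]; rewrite andbT !count_cat.
by have := ballot_count bv; lia.
Qed.

Lemma ballot_drop i v : ballot v -> ballot (drop i v).
Proof. by elim: v i => [|x v IH] [|i] //= /andP[_]; apply: IH. Qed.

Lemma ballot_catr u v : ballot (u ++ v) -> ballot v.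
Proof. by move/(ballot_drop (size u)); rewrite drop_size_cat. Qed.

(** The final ascent pays for [j], whichever letter it is. In a sorted word A B n, [j] is the
    junction of A and B. *)
Lemma ballot_arch j v : ballot v -> ballot (j :: v ++ [:: true]).
Proof.
move=> bv; rewrite /= ballot_cat // andbT !count_cat /=.
by have := ballot_count bv; case: j; lia.
Qed.

Lemma ascents_cat A x B :
  A != [::] -> ascents (A ++ x :: B) =
    ascents A ++ (last 0 A < x) :: ascents (x :: B).
Proof. by case: A => //= a A _; rewrite pairmap_cat. Qed.

Lemma size_ascents w : size (ascents w) = (size w).-1.
Proof. by case: w => //= x w; rewrite size_pairmap. Qed.

(** * Sortable words and their ascent words *)

(** The shape that s(L n R) = s(L) s(R) n gives to sorted words, without mention of preimages. A
    word may admit several splits into A and B; this ambiguity is what unique sorting rules out. *)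
Inductive sortable : seq nat -> Prop :=
| sortable_nil : sortable [::]
| sortable_cat A B n : sortable A -> sortable B ->
    all (ltn^~ n) A -> all (ltn^~ n) B -> sortable (A ++ B ++ [:: n]).

Lemma sortable1 n : sortable [:: n].
Proof. exact: (sortable_cat sortable_nil sortable_nil). Qed.

Lemma sortable_rcons A n :
  sortable A -> all (ltn^~ n) A -> sortable (rcons A n).
Proof.
move=> sA An; rewrite -cats1 -[[:: n]]cat0s.
by apply: sortable_cat => //; apply: sortable_nil.
Qed.

Lemma sortable_last_max w x : sortable w -> x \in w -> x <= last 0 w.
Proof.
case=> // A B n _ _ An Bn; rewrite catA last_cat /= !mem_cat inE.
case/orP=> [/orP[/(allP An)|/(allP Bn)]|/eqP->] //; exact: ltnW.
Qed.

Lemma last_ltn A n : A != [::] -> all (ltn^~ n) A -> last 0 A < n.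
Proof. by case: A => // a A _ /allP An; apply/An/mem_last. Qed.

Lemma ascents_rcons A n :
  A != [::] -> all (ltn^~ n) A -> ascents (A ++ [:: n]) = rcons (ascents A) true.
Proof. by move=> A0 An; rewrite ascents_cat // last_ltn //= cats1. Qed.

Lemma ascents_split A x B n : A != [::] -> all (ltn^~ n) (x :: B) ->
  ascents (A ++ (x :: B) ++ [:: n]) =
    ascents A ++ (last 0 A < x) :: ascents (x :: B) ++ [:: true].
Proof.
move=> A0 Bn; rewrite [(x :: B) ++ _]cat_cons ascents_cat //.
by rewrite -[x :: (B ++ _)]cat_cons ascents_rcons // -cats1.
Qed.

Lemma sortable_ballot w : sortable w -> ballot (ascents w).
Proof.
elim=> // A B n _ bA _ bB An Bn.
have [->|A0] := eqVneq A [::].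
  rewrite cat0s; have [->|B0] := eqVneq B [::]; first by [].
  by rewrite ascents_rcons // -cats1 ballot_cat.
case: B => [|x B] in bB Bn *.
  by rewrite cat0s ascents_rcons // -cats1 ballot_cat.
by rewrite ascents_split // ballot_cat // ballot_arch.
Qed.

(** Balance leaves no surplus: with one block empty the final ascent would be unmatched, and with an
    ascent at the junction there would be two spare ascents. Hence the junction cancels the final
    ascent, and neither block has ascents to spare. *)
Lemma balanced_split A B n :
    sortable A -> sortable B -> all (ltn^~ n) A -> all (ltn^~ n) B ->
    A != [::] \/ B != [::] -> balanced (ascents (A ++ B ++ [:: n])) ->
  [/\ A != [::], B != [::], balanced (ascents A), balanced (ascents B)
    & ~~ (last 0 A < head 0 B)].
Proof.
move=> sA sB An Bn AB; rewrite /balanced.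
have := ballot_count (sortable_ballot sA).
have := ballot_count (sortable_ballot sB).
have [A0|A0] := eqVneq A [::].
  have B0 : B != [::] by case: AB => //; rewrite A0.
  by rewrite A0 cat0s ascents_rcons // -cats1 !count_cat /=; lia.
case: B => [|x B] in sB Bn AB *.
  by rewrite cat0s ascents_rcons // -cats1 !count_cat /=; lia.
rewrite ascents_split // !count_cat /= !count_cat /=.
by case: ltnP => _ *; split=> //; lia.
Qed.

(** The last entry of A is its maximum and lies below the head of B, hence below every maximum
    closing a block that starts there. So A can be pushed down into the leftmost block of B. *)
Lemma sortable_cat_ascent A B : sortable A -> sortable B ->
  A != [::] -> B != [::] -> last 0 A < head 0 B -> sortable (A ++ B).
Proof.
move=> sA sB A0; elim: sB => // B1 B2 n sB1 IH1 sB2 IH2 B1n B2n _ ltAB.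
have ltAn : all (ltn^~ n) A.
  have : head 0 (B1 ++ B2 ++ [:: n]) <= n.
    case: (B1) B1n => [_|? ? /andP[/ltnW]] //.
    by case: (B2) B2n => [|? ? /andP[/ltnW]] /=.
  move=> hn; apply/allP=> x /(sortable_last_max sA) /=; lia.
have [B10|B10] := eqVneq B1 [::].
  rewrite B10 !cat0s in ltAB *; rewrite catA cats1.
  have [B20|B20] := eqVneq B2 [::].
    by rewrite B20 cats0; apply: sortable_rcons.
  apply: sortable_rcons; last by rewrite all_cat ltAn.
  by apply: IH2 => //; move: B20 ltAB; case: (B2).
rewrite catA; apply: sortable_cat => //; last by rewrite all_cat ltAn.
by apply: IH1 => //; move: B10 ltAB; case: (B1).
Qed.

(** The sortable word a B c has maximum c, so it can replace the one-letter block c at the left end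
    of any decomposition of [c :: w]. *)
Lemma sortable_graft a B c w : sortable (c :: w) -> sortable B ->
  a < c -> all (ltn^~ c) B -> sortable (a :: B ++ c :: w).
Proof.
move=> + sB ac Bc; move E: (c :: w) => u su.
elim: su w E => // A C n sA IHA sC IHC An Cn w.
have ltBn m : c < m -> all (ltn^~ m) B.
  by move=> cm; apply: sub_all Bc => x /= /ltn_trans; apply.
case: A => [|x A] in sA IHA An *; last first.
  case=> cx _; rewrite -cx in sA IHA An *.
  move: (IHA _ erefl) => sABn; case/andP: (An) => cn An'.
  have := sortable_cat sABn sC _ Cn; rewrite /= -catA /=; apply.
  by rewrite (ltn_trans ac cn) all_cat ltBn.
rewrite cat0s; case: C => [|y C] in sC IHC Cn *.
  case=> cn _; rewrite -cn in Cn *.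
  have := sortable_cat (sortable1 a) sB _ Bc; rewrite /= ac; exact.
case=> cy _; rewrite -cy in sC IHC Cn *.
have := sortable_rcons (n := n) (IHC _ erefl); rewrite -cats1 /= -catA /=; apply.
by case/andP: (Cn) => cn _; rewrite (ltn_trans ac cn) all_cat ltBn.
Qed.

(** * Sortable words as images of stack sorting *)

Lemma bigmax_mem x w : \max_(y <- x :: w) y \in x :: w.
Proof.
elim: w x => [|y w IH] x; first by rewrite big_seq1 inE.
rewrite big_cons; case: (leqP x (\max_(j <- y :: w) j)) => _.
  by rewrite inE IH orbT.
by rewrite inE eqxx.
Qed.

Lemma uniq_split_max (q : seq nat) : uniq q -> q != [::] ->
  exists L n R, [/\ q = L ++ n :: R, all (ltn^~ n) L & all (ltn^~ n) R].
Proof.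
case: q => // x w + _; set q := x :: w => uq.
have := bigmax_mem x w; rewrite -/q; move: (erefl (\max_(y <- q) y)).
move: {1 3}(\max_(y <- q) y) => n En nq.
have leqn y : y \in q -> y <= n by move=> yq; rewrite En (@leq_bigmax_seq _ _ _ id).
case/splitPr: nq leqn uq => L R leqn; rewrite uniq_catC /= mem_cat.
case/andP=> /norP[nR nL] _; exists L, n, R.
split=> //; apply/allP => y yq; rewrite ltn_neqAle leqn ?mem_cat ?inE ?yq ?orbT // andbT.
  by apply: contraNneq nL => <-.
by apply: contraNneq nR => <-.
Qed.

Lemma perm_stack_sort w : perm_eq (stack_sort w) w.
Proof.
rewrite /stack_sort; move: (leqnn (size w)); move: {2 3}(size w) => f.
elim: f w => [|f IH] [|x w] // lewf.
set q := x :: w in lewf *; set n := \max_(y <- q) y.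
have -> : stack_sort_rec f.+1 q =
  stack_sort_rec f (take (index n q) q) ++
    stack_sort_rec f (drop (index n q).+1 q) ++ [:: n] by [].
have nq : n \in q by apply: bigmax_mem.
have lewf' : size w <= f by exact: lewf.
have ltiq : index n q <= size w by move: nq; rewrite -index_mem.
rewrite -[X in perm_eq _ X](cat_take_drop (index n q))
  (drop_nth 0 (n := index n q)) ?index_mem // nth_index //.
rewrite perm_cat // ?IH //; last first.
  by rewrite cats1 perm_rcons perm_cons IH // size_drop /=; move: lewf => /=; lia.
by rewrite size_take_min; lia.
Qed.

Lemma stack_sort_inv (q w' : seq nat) n : uniq q -> stack_sort q = rcons w' n ->
  exists L R, [/\ q = L ++ n :: R, stack_sort L ++ stack_sort R = w',
    all (ltn^~ n) L & all (ltn^~ n) R].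
Proof.
move=> uq Eq; have q0 : q != [::] by apply: contra_eq_neq Eq => ->; case: (w').
have [L [m [R [Eq' Lm Rm]]]] := uniq_split_max uq q0.
move: Eq; rewrite Eq' stack_sortE // catA cats1 => /rcons_inj[<- mn].
by exists L, R; rewrite -mn.
Qed.

Lemma stack_sort_sortable (q : seq nat) : uniq q -> sortable (stack_sort q).
Proof.
have [f] := ubnP (size q); elim: f q => // f IH q leqf uq.
have [->|q0] := eqVneq q [::]; first exact: sortable_nil.
have [L [n [R [Eq Ln Rn]]]] := uniq_split_max uq q0.
move: leqf uq; rewrite Eq size_cat cat_uniq /= => leqf /and3P[uL _ /andP[_ uR]].
rewrite stack_sortE //; apply: sortable_cat; try by apply: IH => //; lia.
  by rewrite (perm_all _ (perm_stack_sort L)).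
by rewrite (perm_all _ (perm_stack_sort R)).
Qed.

Lemma sortable_preimage w : sortable w -> exists q, stack_sort q = w.
Proof.
elim=> [|A B n _ [L EL] _ [R ER] An Bn]; first by exists [::].
exists (L ++ n :: R); rewrite stack_sortE ?EL ?ER //.
  by rewrite -(perm_all _ (perm_stack_sort L)) EL.
by rewrite -(perm_all _ (perm_stack_sort R)) ER.
Qed.

(** * A sorted word has one preimage exactly when it is balanced *)

(* If [A] were shorter than [A'], the suffix of [B] starting at the last entry
   of [A'] would begin with a descent and be otherwise balanced. *)
Lemma balanced_split_leq A B A' B' n :
    sortable A -> sortable B -> sortable A' -> sortable B' ->
    all (ltn^~ n) (A ++ B) -> A ++ B = A' ++ B' ->
    balanced (ascents (A ++ B ++ [:: n])) -> size A' <= size A.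
Proof.
move=> sA sB sA' sB' ABn EAB bal; rewrite leqNgt; apply/negP => ltAA'.
have EA : take (size A) A' = A.
  by have := congr1 (take (size A)) EAB; rewrite take_size_cat // takel_cat // ltnW.
move: EAB; rewrite -(cat_take_drop (size A) A') EA -catA => /eqP.
rewrite eqseq_cat // eqxx /= => /eqP EB.
set C := drop (size A) A' in EB.
have C0 : C != [::] by rewrite -size_eq0 size_drop subn_eq0 -ltnNge.
have EA' : A' = A ++ C by rewrite -EA cat_take_drop.
move: (ABn); rewrite all_cat => /andP[An Bn].
have [A0|A0] := eqVneq A [::].
  have [] := balanced_split sA sB An Bn _ bal; last by rewrite A0.
  by right; rewrite EB; case: (C) C0.
have B0 : B != [::] by rewrite EB; case: (C) C0.
have [_ _ balA balB _] := balanced_split sA sB An Bn (or_introl A0) bal.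
have A'n : all (ltn^~ n) A' /\ all (ltn^~ n) B'.
  by move: ABn; rewrite EB catA -EA' all_cat => /andP[].
have bal' : balanced (ascents (A' ++ B' ++ [:: n])).
  by rewrite EA' -catA (catA C) -EB.
have A'0 : A' != [::] by rewrite EA'; case: (A) A0.
have [_ B'0 _ balB' desc] :=
  balanced_split sA' sB' A'n.1 A'n.2 (or_introl A'0) bal'.
case: B' => // y B' in EB B'0 balB' desc {sB' A'n bal'}.
have := sortable_ballot sB; rewrite EB ascents_cat // => /ballot_catr.
have -> : last 0 C < y = false.
  apply: negbTE; move: desc; rewrite EA' /=; case: (C) C0 => //= c C' _.
  by rewrite last_cat.
by move: balB'; rewrite /balanced /=; lia.
Qed.

(** Comparing the two preimages in both directions with [balanced_split_leq] shows that they cut w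
    at the same place. The blocks are balanced again, so induction on the length applies. *)
Lemma balanced_preimage_uniq (w q q' : seq nat) : uniq q -> uniq q' ->
  stack_sort q = w -> stack_sort q' = w -> balanced (ascents w) -> q = q'.
Proof.
have [f] := ubnP (size w); elim: f w q q' => // f IH w q q' lewf uq uq' Eq Eq'.
case/lastP: w => [|w n] in lewf Eq Eq' *.
  move=> _; have /perm_size := perm_stack_sort q.
  have /perm_size := perm_stack_sort q'; rewrite Eq Eq' /=.
  by case: (q) => //; case: (q').
have [L [R [Eq1 ELR Ln Rn]]] := stack_sort_inv uq Eq.
have [L' [R' [Eq1' ELR' Ln' Rn']]] := stack_sort_inv uq' Eq'.
rewrite size_rcons ltnS in lewf.
move: uq uq'; rewrite Eq1 Eq1' !cat_uniq.
move=> /and3P[uL _ /andP[_ uR]] /and3P[uL' _ /andP[_ uR']].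
have sL := stack_sort_sortable uL; have sR := stack_sort_sortable uR.
have sL' := stack_sort_sortable uL'; have sR' := stack_sort_sortable uR'.
have lt_sort u : all (ltn^~ n) u -> all (ltn^~ n) (stack_sort u).
  by rewrite (perm_all _ (perm_stack_sort u)).
move=> bal; have eqLL' : size (stack_sort L) = size (stack_sort L').
  apply/eqP; rewrite eqn_leq; apply/andP; split.
    apply: (balanced_split_leq (n := n) sL' sR' sL sR); rewrite ?all_cat ?lt_sort //.
      by rewrite ELR ELR'.
    by rewrite catA ELR' cats1.
  apply: (balanced_split_leq (n := n) sL sR sL' sR'); rewrite ?all_cat ?lt_sort //.
    by rewrite ELR ELR'.
  by rewrite catA ELR cats1.
move/eqP: (ELR); rewrite -ELR' eqseq_cat // => /andP[/eqP EL /eqP ER].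
have leL : size (stack_sort L) < f by move: lewf; rewrite -ELR size_cat; lia.
have leR : size (stack_sort R) < f by move: lewf; rewrite -ELR size_cat; lia.
have [LR0|LR0] := eqVneq (L ++ R) [::].
  have [L0 R0] : L = [::] /\ R = [::] by case: (L) LR0; case: (R).
  move: EL ER; rewrite L0 R0 => EL ER.
  have := perm_size (perm_stack_sort L'); have := perm_size (perm_stack_sort R').
  by rewrite -EL -ER; case: (L'); case: (R').
have [||_ _ balL balR _] := balanced_split sL sR (lt_sort _ Ln) (lt_sort _ Rn).
- have sort0 u : u != [::] -> stack_sort u != [::].
    by rewrite -!size_eq0 (perm_size (perm_stack_sort u)).
  case: (eqVneq L [::]) => [L0|/sort0]; last by left.
  by right; apply: sort0; move: LR0; rewrite L0.
- by rewrite catA ELR cats1.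
by rewrite (IH _ _ _ leL uL uL' erefl (esym EL) balL)
           (IH _ _ _ leR uR uR' erefl (esym ER) balR).
Qed.

(** Unless w is one letter, uniqueness forces A and B to be nonempty with a descent between them,
    since otherwise [A ++ B] is sortable. Uniqueness then passes to A and B, and induction gives
    balance. *)
Lemma preimage_uniq_balanced w : sortable w -> uniq w ->
  (forall q q', stack_sort q = w -> stack_sort q' = w -> q = q') ->
  balanced (ascents w).
Proof.
elim=> // A B n sA IHA sB IHB An Bn uw inj.
have [L EL] := sortable_preimage sA; have [R ER] := sortable_preimage sB.
have ltl u v : stack_sort u = v -> all (ltn^~ n) v -> all (ltn^~ n) u.
  by move=> <-; rewrite (perm_all _ (perm_stack_sort u)).
have notl u : all (ltn^~ n) u -> n \notin u.
  by move=> un; apply/negP => /(allP un) /=; rewrite ltnn.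
have sortE u v u' v' : stack_sort u = u' -> stack_sort v = v' ->
    all (ltn^~ n) u' -> all (ltn^~ n) v' ->
    stack_sort (u ++ n :: v) = u' ++ v' ++ [:: n].
  by move=> Eu Ev un vn; rewrite stack_sortE ?Eu ?Ev // ?(ltl _ _ Eu) // (ltl _ _ Ev).
have sort0 u v : stack_sort u = v -> v != [::] -> u != [::].
  by move=> <-; apply: contra_neq => ->.
have injn u v u' v' : all (ltn^~ n) u -> all (ltn^~ n) u' ->
    u ++ n :: v = u' ++ n :: v' -> size u = size u'.
  move=> un un' /(congr1 (index n)).
  by rewrite !index_cat !(negPf (notl _ _)) //= eqxx !addn0.
(* A preimage Q of [A ++ B] yields two preimages of the whole word, Q n and n Q; they coincide only
   when Q is empty. *)
have AB0 C : sortable C -> all (ltn^~ n) C -> A ++ B = C -> C = [::].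
  move=> sC Cn EC; have [Q EQ] := sortable_preimage sC.
  have E1 := sortE _ _ _ _ EQ stack_sort0 Cn isT.
  have E2 := sortE _ _ _ _ stack_sort0 EQ isT Cn.
  rewrite catA EC cats1 -cats1 in inj.
  have /(injn Q [::] [::] Q (ltl _ _ EQ Cn) isT)/size0nil Q0 := inj _ _ E1 E2.
  by rewrite -EQ Q0.
have [A0|A0] := eqVneq A [::].
  by have := AB0 B sB Bn; rewrite A0 => ->.
have [B0|B0] := eqVneq B [::].
  by have := AB0 A sA An; rewrite B0 cats0 => ->.
have asc : ~~ (last 0 A < head 0 B).
  apply/negP=> asc; have := AB0 _ (sortable_cat_ascent sA sB A0 B0 asc) _ erefl.
  by rewrite all_cat An Bn => /(_ isT); case: (A) A0.
move: uw; rewrite cat_uniq => /and3P[uA _]; rewrite cat_uniq => /andP[uB _].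
have balA : balanced (ascents A).
  apply: IHA => // q q' Eq Eq'.
  have := inj (q ++ n :: R) (q' ++ n :: R); rewrite !(sortE _ _ A B) //.
  move=> /(_ erefl erefl) /eqP; rewrite eqseq_cat ?eqxx ?andbT => [/eqP //|].
  by rewrite -(perm_size (perm_stack_sort q)) -(perm_size (perm_stack_sort q')) Eq Eq'.
have balB : balanced (ascents B).
  apply: IHB => // q q' Eq Eq'.
  have := inj (L ++ n :: q) (L ++ n :: q'); rewrite !(sortE _ _ A B) //.
  by move=> /(_ erefl erefl) /eqP; rewrite eqseq_cat // eqxx /= => /eqP[].
clear IHB uB ER AB0 inj sortE.
case: B => // x B in sB Bn B0 asc balB *.
rewrite ascents_split // (negbTE asc).
by move: balA balB; rewrite /balanced !count_cat /= !count_cat /=; lia.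
Qed.

(** * Extremal words as chains of sortable words *)

Lemma eq_cat_split (T : eqType) (R S A Z : seq T) : R ++ S = A ++ Z ->
  size R <= size A -> exists2 A', A = R ++ A' & S = A' ++ Z.
Proof.
move=> E leRA; exists (drop (size R) A).
  have := congr1 (take (size R)) E; rewrite take_size_cat // takel_cat // => {1}->.
  by rewrite cat_take_drop.
have := congr1 (drop (size R)) E; rewrite drop_size_cat // drop_cat.
case: ltnP => // leAR.
have -> : size R = size A by apply/eqP; rewrite eqn_leq leRA.
by rewrite subnn drop0 drop_size.
Qed.

(** Meant for words with e more ascents than descents: e + 1 sortable blocks, joined by the
    unmatched ascents. *)
Inductive ascent_chain : nat -> seq nat -> Prop :=
| ascent_chain0 x w : sortable (x :: w) -> ascent_chain 0 (x :: w)
| ascent_chainS e A x w : sortable A -> A != [::] -> last 0 A < x ->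
    ascent_chain e (x :: w) -> ascent_chain e.+1 (A ++ x :: w).

Lemma ascent_chain0_inv w : ascent_chain 0 w -> sortable w.
Proof. by move E: 0 => e ch; case: ch E. Qed.

Lemma ascent_chain_graft e a B c w : ascent_chain e (c :: w) -> sortable B ->
  a < c -> all (ltn^~ c) B -> ascent_chain e (a :: B ++ c :: w).
Proof.
move=> + sB ac Bc; move E: (c :: w) => u chu.
case: chu E => [x w' sw [cx _]|e' [//|y A] x w' sA _ ltAx chw [cy _]].
  by rewrite -cx in sw *; apply/ascent_chain0/sortable_graft.
rewrite catA -cat_cons -cy in sA ltAx *; apply: ascent_chainS => //.
  exact: sortable_graft.
by rewrite /= last_cat.
Qed.

(** No entry of w lies between two earlier ones. For p empty and distinct entries these are the
    words avoiding 132 and 312. *)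
Fixpoint extremal (p w : seq nat) : bool :=
  if w is x :: w' then (all (ltn^~ x) p || all (ltn x) p) && extremal (rcons p x) w'
  else true.

Lemma extremal_cat p X Y :
  extremal p (X ++ Y) = extremal p X && extremal (p ++ X) Y.
Proof.
elim: X p => [|x X IH] p /=; first by rewrite cats0.
by rewrite IH cat_rcons andbA.
Qed.

Lemma extremal_sub p p' w : {subset p' <= p} -> extremal p w -> extremal p' w.
Proof.
elim: w p p' => //= x w IH p p' sub /andP[ext_x /IH ->]; rewrite ?andbT.
  case/orP: ext_x => /allP h; [apply/orP; left|apply/orP; right];
    by apply/allP=> y /sub/h.
by move=> y; rewrite !mem_rcons !inE => /orP[->//|/sub->]; rewrite orbT.
Qed.

(** Each entry is a new maximum or a new minimum, so comparison with its predecessor decides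
    which. *)
Lemma extremal_ascent p X c Z : extremal p (X ++ c :: Z) -> p ++ X != [::] ->
  last 0 (p ++ X) < c -> all (ltn^~ c) (p ++ X).
Proof.
rewrite extremal_cat /= => /and3P[_ /orP[//|gtc] _]; case: (p ++ X) gtc => // x u gtc _.
by have := allP gtc _ (mem_last x u) => /=; lia.
Qed.

(** An ascent out of a adds the block [[:: a]]. A descent uses up the ascent after the first block:
    its top is a new maximum, so a and that block can be grafted onto the next one. *)
Lemma extremal_chain a w : extremal [:: a] w -> ballot (pairmap ltn a w) ->
  ascent_chain (count id (pairmap ltn a w) - count negb (pairmap ltn a w)) (a :: w).
Proof.
elim: w a => [|x w IH] a; first by move=> _ _; apply/ascent_chain0/sortable1.
move=> ext; have extx : extremal [:: x] w.
  case/andP: ext => _; apply: extremal_sub => y.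
  by rewrite mem_rcons !inE => ->.
rewrite [pairmap _ _ _]/= => /andP[le_ax ball]; have := IH x extx ball.
have := ballot_count ball; move: le_ax => /=; case: ltnP => /= ax leax leb chx.
  rewrite addnC addn1 add0n subSn //; apply: (ascent_chainS (A := [:: a])) => //.
  exact: sortable1.
rewrite add0n; move: chx.
set e := _ - count negb _.
(* The descent out of a must be matched later, so the chain starting at x has positive surplus. *)
have -> : e = (count id (pairmap ltn x w) - (true + count negb (pairmap ltn x w))).+1.
  by rewrite /e; lia.
move: (_ - _) => f; move Ef: (f.+1) => g; move Eu: (x :: w) => u chu.
case: chu Ef Eu => // e' A y w' sA A0 ltAy chw [->] Eu.
rewrite Eu in ext; have := extremal_ascent ext isT.
have -> : last 0 ([:: a] ++ A) = last 0 A by case: (A) A0.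
by move=> /(_ ltAy) /= /andP[ay Ay]; apply: ascent_chain_graft.
Qed.

(** * Layered words and their sortability *)

(** The default 0 makes [a < head 0 S] fail for empty S, so S is nonempty as well. *)
Definition layered a (R S : seq nat) : bool :=
  [&& R != [::], all (ltn^~ a) R, extremal [::] R, a < head 0 S
    & extremal (a :: R) S].

(* With r the ascents of R and s those of S, this says that the ascent starting S
   comes no later than the first return of the Dyck word false :: r ++ s. *)
Fixpoint marked (r s : seq bool) : bool :=
  if r is _ :: r' then (count negb (r ++ s) < count id (r ++ s)) && marked r' s
  else if s is true :: s' then ballot s' else false.

Lemma marked_count r s : marked r s -> count negb (r ++ s) < count id (r ++ s).
Proof.
case: r => [|x r] /=; last by case/andP.
by case: s => [|[] s] //= /ballot_count; lia.
Qed.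

Lemma marked_ballot r s : marked r s -> ballot (r ++ s).
Proof.
elim: r => [|x r IH] /=; last by move=> /andP[/ltnW -> /IH].
by case: s => [|[] s] //= bs; rewrite bs andbT; have := ballot_count bs; lia.
Qed.

Lemma marked_catr r1 r2 s : marked (r1 ++ r2) s -> marked r2 s.
Proof. by elim: r1 => //= x r1 IH /andP[_]. Qed.

(** The tail t is neutral and the ascent before it adds one, which turns the weak inequalities for
    [r ++ s] into strict ones. *)
Lemma ballot_marked r s t : ballot (r ++ s) -> balanced t ->
  marked [::] (s ++ true :: t) -> marked r (s ++ true :: t).
Proof.
move=> + balt ms; elim: r => // x r IH /= /andP[le_x /IH ->]; rewrite andbT.
by move: balt le_x; rewrite /balanced !count_cat /=; lia.
Qed.

Definition layer_ascents (R S : seq nat) := pairmap ltn (last 0 R) S.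

Lemma layered_ascents a R S : layered a R S ->
  ascents (a :: R ++ S) = false :: ascents R ++ layer_ascents R S.
Proof.
case: R => // b R /and5P[_ /= /andP[ba _] _ _ _].
by rewrite pairmap_cat ltnNge ltnW.
Qed.

Lemma layer_ascents_head a R S : layered a R S ->
  exists2 s, layer_ascents R S = true :: s & S != [::].
Proof.
case: S => [|y S] /and5P[R0 Ra _ //= ay _].
by exists (pairmap ltn y S) => //; rewrite /layer_ascents /= (ltn_trans _ ay) // last_ltn.
Qed.

(** Here c is the top of the ascent matched with the descent leaving a. It is found by descending
    into leftmost blocks until A is the single letter a; then B and n close the arch. *)
Lemma sortable_first_arch a w : sortable (a :: w) -> w != [::] ->
  balanced (ascents (a :: w)) ->
  exists B c t, [/\ w = B ++ c :: t, B != [::] /\ last 0 B < c, a < c,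
    ballot (ascents B) & balanced (ascents (c :: t))].
Proof.
move E: (a :: w) => u su; elim: su a w E => // A B n sA IHA sB _ An Bn a w E w0 bal.
have AB : A != [::] \/ B != [::].
  by case: (A) (B) E => [|? ?] [|? ?]; [case=> _ Ew; rewrite Ew in w0|right|left|left].
have [A0 B0 balA balB desc] := balanced_split sA sB An Bn AB bal.
case: A => // x A in sA IHA An E A0 balA desc {AB bal} *.
case: E => Ex Ew; subst x; case/andP: (An) => ltan An'.
have [A'0|A'0] := eqVneq A [::].
  exists B, n, [::]; split=> //; last exact: sortable_ballot.
    by rewrite Ew A'0.
  by split=> //; apply: last_ltn.
have [B' [c [t [EA B'0 ltac balB' balt]]]] := IHA a A erefl A'0 balA.
exists B', c, (t ++ B ++ [:: n]); split=> //; first by rewrite Ew EA -catA.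
case: B => // y B in sB Bn B0 balB desc {Ew IHA} *.
rewrite -cat_cons ascents_split //.
have -> : last 0 (c :: t) < y = false.
  by apply: negbTE; move: desc; rewrite EA /= last_cat.
by move: balB balt; rewrite /balanced !count_cat /= !count_cat /=; lia.
Qed.

Lemma sortable_marked a R S : layered a R S -> sortable (a :: R ++ S) ->
  balanced (ascents (a :: R ++ S)) -> marked (ascents R) (layer_ascents R S).
Proof.
move=> lay sw bal; have [s Es S0] := layer_ascents_head lay.
have /and5P[R0 Ra _ _ _] := lay.
have RS0 : R ++ S != [::] by case: (R) R0.
have [B [c [t [E [B0 ltBc] ltac balB balt]]]] := sortable_first_arch sw RS0 bal.
(* Since c is above a while R lies below it, c is not in R: the first return cannot precede the
   start of S. *)
have leRB : size R <= size B.
  rewrite leqNgt; apply/negP => ltBR.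
  have [R' ER _] := eq_cat_split (esym E) (ltnW ltBR).
  move: ltBR E Ra; rewrite ER -catA size_cat all_cat; case: (R') => [|y R''].
    by rewrite addn0 ltnn.
  move=> _ /eqP; rewrite eqseq_cat // eqxx => /eqP[-> _] /and3P[_ /= ca _]; lia.
have [S' EB ES] := eq_cat_split E leRB.
have Els : layer_ascents R S = layer_ascents R S' ++ true :: ascents (c :: t).
  rewrite /layer_ascents ES pairmap_cat /=; congr (_ ++ _ :: _).
  by rewrite -last_cat -EB ltBc.
have := sortable_ballot sw; rewrite layered_ascents // => /andP[_ /ballot_catr].
rewrite Els => bals; apply: ballot_marked => //.
  by move: balB; rewrite EB; case: (R) R0 => //= b R1 _; rewrite pairmap_cat.
by move: Es bals; rewrite Els => -> /= /andP[].
Qed.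

(** The word [R ++ S] has surplus 1, hence is two sortable blocks A and [x :: w] joined by an
    ascent. The mark puts x in S, where an ascent reaches a new maximum, so a and A are grafted onto
    [x :: w]. *)
Lemma marked_sortable a R S : layered a R S ->
  marked (ascents R) (layer_ascents R S) -> balanced (ascents (a :: R ++ S)) ->
  sortable (a :: R ++ S).
Proof.
move=> lay mark; rewrite layered_ascents // => bal.
have [s Es S0] := layer_ascents_head lay.
have /and5P[R0 Ra extR _ extS] := lay.
have : ascent_chain 1 (R ++ S).
  case: R R0 extR extS mark bal {Ra lay Es} => //= b R _ extR extS mark bal.
  have := @extremal_chain b (R ++ S); rewrite extremal_cat extR pairmap_cat.
  rewrite (extremal_sub _ extS) => [/(_ isT)|y]; last by move=> yR; apply/orP; right.
  rewrite (marked_ballot mark) => /(_ isT).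
  move: bal; rewrite /balanced /layer_ascents /= add0n => /eqP <-.
  by rewrite addnK.
move Ee: {1}(1) => e; move Eu: (R ++ S) => u chu.
case: chu Ee Eu => // e' A x w sA A0 ltAx chw [Ee] E.
have sxw : sortable (x :: w).
  by apply: ascent_chain0_inv; rewrite Ee.
have Easc : ascents R ++ layer_ascents R S = ascents A ++ true :: ascents (x :: w).
  rewrite -ltAx -ascents_cat // -E; case: (R) R0 => //= b R1 _.
  by rewrite pairmap_cat.
have balx : balanced (ascents (x :: w)).
  move: bal; rewrite Easc; have := ballot_count (sortable_ballot sA).
  have := ballot_count (sortable_ballot sxw).
  by rewrite /balanced /= !count_cat /=; lia.
(* If x were in R, the strict inequality in [marked] would contradict the balance of [x :: w]. *)
have leRA : size R <= size A.
  rewrite leqNgt; apply/negP => ltAR.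
  have [R' ER Exw] := eq_cat_split (esym E) (ltnW ltAR).
  case: R' => [|y R'] in ER Exw.
    by rewrite ER cats0 ltnn in ltAR.
  case: Exw => xy Ew; rewrite -{}xy in ER.
  move: mark; rewrite /layer_ascents ER ascents_cat // -cat1s catA.
  move=> /marked_catr/marked_count.
  rewrite last_cat /= -pairmap_cat -Ew; move: balx; rewrite /balanced /=; lia.
have [A' EA ES] := eq_cat_split E leRA.
have := @extremal_ascent (a :: R) A' x w; rewrite -ES extS => /(_ isT isT).
rewrite cat_cons -EA => h; have /andP[ax Ax] : all (ltn^~ x) (a :: A).
  by apply: h; case: (A) A0 ltAx.
exact: sortable_graft.
Qed.

(** * Layered words and avoidance of 132 and 4312 *)

Lemma order_isoP u t :
  reflect (size u = size t /\ forall i j, i < size t -> j < size t ->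
             (nth 0 u i < nth 0 u j) = (nth 0 t i < nth 0 t j))
          (order_iso u t).
Proof.
apply: (iffP andP) => [[/eqP su /forallP h]|[/eqP su h]]; split=> //.
  move=> i j it jt.
  by have /forallP/(_ (Ordinal jt))/eqP := h (Ordinal it).
by apply/forallP=> i; apply/forallP=> j; rewrite h.
Qed.

Lemma contains_132P w :
  reflect (exists x z y, [/\ subseq [:: x; z; y] w, x < y & y < z])
          (contains_pattern w [:: 1; 3; 2]).
Proof.
apply: (iffP (contains_patternP _ _)) => [[u uw]|[x [z [y [uw xy yz]]]]].
  case/order_isoP; case: u uw => [|x [|z [|y []]]] //= uw _ h.
  by exists x, z, y; split=> //; [rewrite (h 0 2)|rewrite (h 2 1)].
exists [:: x; z; y] => //; apply/order_isoP; split=> // i j.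
by case: i => [|[|[|i]]] //; case: j => [|[|[|j]]] //= _ _; lia.
Qed.

Lemma contains_4312P w :
  reflect (exists p q r t, [/\ subseq [:: p; q; r; t] w, q < p, t < q & r < t])
          (contains_pattern w [:: 4; 3; 1; 2]).
Proof.
apply: (iffP (contains_patternP _ _)) => [[u uw]|[p [q [r [t [uw qp tq rt]]]]]].
  case/order_isoP; case: u uw => [|p [|q [|r [|t []]]]] //= uw _ h.
  by exists p, q, r, t; split=> //; [rewrite (h 1 0)|rewrite (h 3 1)|rewrite (h 2 3)].
exists [:: p; q; r; t] => //; apply/order_isoP; split=> // i j.
by case: i => [|[|[|[|i]]]] //; case: j => [|[|[|[|j]]]] //= _ _; lia.
Qed.

Lemma subseq_rcons_split (T : eqType) (u : seq T) y w : subseq (rcons u y) w ->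
  exists P Q, w = P ++ y :: Q /\ subseq u P.
Proof.
elim: w u => [|x w IH] u; first by case: u.
case: u => [|z u] /=; case: eqP => [->|_].
- by exists [::], w.
- by move/(IH [::]) => [P [Q [-> _]]]; exists (x :: P), Q; rewrite sub0seq.
- by move/IH => [P [Q [-> sub]]]; exists (x :: P), Q; rewrite /= eqxx.
- move/(IH (z :: u)) => [P [Q [-> sub]]]; exists (x :: P), Q; split=> //.
  exact: subseq_trans sub (subseq_cons _ _).
Qed.

Lemma extremal_mid p X c Z : extremal p (X ++ c :: Z) ->
  all (ltn^~ c) (p ++ X) || all (ltn c) (p ++ X).
Proof. by rewrite extremal_cat /= => /and3P[]. Qed.

Lemma extremal_not_between p X c Z x y : extremal p (X ++ c :: Z) ->
  x \in p ++ X -> y \in p ++ X -> x < c -> c < y -> False.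
Proof.
move/extremal_mid => /orP[] /allP h /h /= + /h /=; lia.
Qed.

(** Both patterns end with an entry between two earlier ones, as 132 or as the 312 inside 4312. In a
    layered word this forces that last entry into R and the first of the two to be a. Then 132 fails
    since R is below a, and 4312 since nothing precedes a. *)
Lemma layered_avoid a R S : layered a R S ->
  avoids_pattern (a :: R ++ S) [:: 1; 3; 2] /\
  avoids_pattern (a :: R ++ S) [:: 4; 3; 1; 2].
Proof.
case/and5P=> R0 Ra extR aS extS.
have split P y Q (x z : nat) : a :: R ++ S = P ++ y :: Q -> subseq [:: x; z] P ->
    (x < y < z) || (z < y < x) ->
      [/\ x = a, y < a & all (ltn^~ a) (behead P)].
  case: P => [|a' P] // [<- {a'}] E sub xyz.
  have [xP zP] : x \in a :: P /\ z \in a :: P.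
    by split; apply: (mem_subseq sub); rewrite !inE eqxx ?orbT.
  have [leRP|/ltnW ltPR] := leqP (size R) (size P).
    have [P' EP ES] := eq_cat_split E leRP.
    have := @extremal_not_between (a :: R) P' y Q.
    rewrite -ES cat_cons -EP => /(_ _ _ extS).
    by case/orP: xyz => /andP[? ?] h; [case: (h x z)|case: (h z x)].
  have [R' ER EyQ] := eq_cat_split (esym E) ltPR.
  case: R' => [|y' R'] in ER EyQ.
    have := @extremal_not_between (a :: R) [::] y Q.
    rewrite cat0s EyQ /= cats0 => /(_ _ _ extS); rewrite ER cats0.
    by case/orP: xyz => /andP[? ?] h; [case: (h x z)|case: (h z x)].
  case: EyQ => yy' _; rewrite -{}yy' {y'} in ER.
  have ya : y < a by apply: (allP Ra); rewrite ER mem_cat inE eqxx orbT.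
  have Pa : all (ltn^~ a) P by move: Ra; rewrite ER all_cat => /andP[].
  move: sub => /=; case: eqP => [-> //|_] sub; exfalso.
  have := @extremal_not_between [::] P y R'; rewrite -ER => /(_ _ _ extR) h.
  have [xP' zP'] : x \in P /\ z \in P.
    by split; apply: (mem_subseq sub); rewrite !inE eqxx ?orbT.
  by case/orP: xyz => /andP[? ?]; [case: (h x z)|case: (h z x)].
split; apply/negP.
  case/contains_132P=> x [z [y []]].
  move=> /(@subseq_rcons_split _ [:: x; z])[P [Q [E sub]]] xy yz.
  have [|xa ya _] := split _ _ _ _ _ E sub; first by rewrite xy yz.
  by move: ya xy; rewrite xa; lia.
case/contains_4312P=> p [q [r [t []]]].
move=> /(@subseq_rcons_split _ [:: p; q; r])[P [Q [E sub]]] qp tq rt.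
have sub' : subseq [:: q; r] P by apply: subseq_trans sub; apply: subseq_cons.
have [|qa ta Pa] := split _ _ _ _ _ E sub'; first by rewrite tq rt orbT.
case: P sub Pa {E sub'} => // a' P sub Pa.
have : subseq [:: q; r] P by move: sub => /=; case: ifP => // _ /cons_subseq.
by move/mem_subseq/(_ q); rewrite inE eqxx => /(_ isT)/(allP Pa) /=; lia.
Qed.

Lemma mem_subseq2 (T : eqType) (w : seq T) x y : x \in w -> y \in w -> x != y ->
  subseq [:: x; y] w || subseq [:: y; x] w.
Proof.
case/splitPr=> P Q; rewrite mem_cat inE => /or3P[yP|/eqP->|yQ]; last 2 first.
- by rewrite eqxx.
- move=> _; apply/orP; left; rewrite -[[:: x; y]]cat0s cat_subseq ?sub0seq //=.
  by rewrite eqxx sub1seq.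
move=> _; apply/orP; right; rewrite -[[:: y; x]]/([:: y] ++ [:: x]).
by rewrite cat_subseq ?sub1seq ?mem_head.
Qed.

Lemma extremal_uniq p w : uniq (p ++ w) ->
  (forall X c Z x y, w = X ++ c :: Z -> x \in p ++ X -> y \in p ++ X ->
     x < c -> c < y -> False) -> extremal p w.
Proof.
elim: w p => //= c w IH p up h; apply/andP; split; last first.
  apply: IH; first by rewrite cat_rcons.
  by move=> X d Z x y E; rewrite cat_rcons; apply: (h (c :: X) d Z); rewrite E.
have cp : c \notin p.
  by move: up; rewrite cat_uniq /= => /and3P[_ /norP[]].
have [|/allPn[y yp yc]] := boolP (all (ltn^~ c) p) => //=.
apply/allP=> x xp; rewrite /= ltn_neqAle leqNgt.
have neq z : z \in p -> c != z by apply: contraTneq => <-.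
rewrite neq //=; apply/negP => xc.
apply: (h [::] c w x y) => //; rewrite ?cats0 //.
by move: yc => /=; rewrite -leqNgt ltn_neqAle neq.
Qed.

(** Cut at the first entry m above a, which exists because the last entry is the maximum. A
    non-extremal entry of R ends a 132 or a 312, and a in front of the latter makes a 4312. *)
Lemma avoid_layered a b (w : seq nat) : uniq (a :: b :: w) -> b < a ->
    all (leq^~ (last b w)) (a :: b :: w) ->
    avoids_pattern (a :: b :: w) [:: 1; 3; 2] ->
    avoids_pattern (a :: b :: w) [:: 4; 3; 1; 2] ->
  exists R S, b :: w = R ++ S /\ layered a R S.
Proof.
move=> uw ba lastw /contains_132P h132 /contains_4312P h4312.
have {}h132 x z y : subseq [:: x; z; y] (a :: b :: w) -> x < y -> y < z -> False.
  by move=> *; apply: h132; exists x, z, y.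
have {}h4312 p q r t : subseq [:: p; q; r; t] (a :: b :: w) ->
    q < p -> t < q -> r < t -> False.
  by move=> *; apply: h4312; exists p, q, r, t.
have has_gt : has (ltn a) (b :: w).
  apply/hasP; exists (last b w); first exact: mem_last.
  have /andP[lea _] := lastw; rewrite /= ltn_neqAle lea andbT.
  by move: uw => /andP[aw _]; apply: contraNneq aw => ->; apply: mem_last.
have [R [m [S [E gtm ngtR]]]] : exists R m S,
    [/\ b :: w = R ++ m :: S, a < m & ~~ has (ltn a) R].
  move E: (b :: w) has_gt => u /split_find[m R S am ngt].
  by exists R, m, S; rewrite cat_rcons.
exists R, (m :: S); split=> //; rewrite E in uw h132 h4312.
have Ra : all (ltn^~ a) R.
  apply/allP=> y yR; move/hasPn/(_ y yR): ngtR => /=; rewrite -leqNgt leq_eqVlt.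
  case: eqP uw => // <- /=; by rewrite mem_cat yR.
have R0 : R != [::].
  by apply: contraTneq gtm => R0; move: E; rewrite R0 => -[<- _]; rewrite -leqNgt ltnW.
have sub2 X c Z x y : x \in X -> y \in X -> x != y ->
    subseq [:: x; y; c] (X ++ c :: Z) \/ subseq [:: y; x; c] (X ++ c :: Z).
  move=> xX yX xy; have sub1 : subseq [:: c] (c :: Z) by rewrite /= eqxx sub0seq.
  by case/orP: (mem_subseq2 xX yX xy) => h; [left|right];
     apply: (cat_subseq h sub1).
apply/and5P; split=> //.
  apply: extremal_uniq => [|X c Z x y ER xX yX xc cy].
    by move: uw; rewrite /= cat_uniq => /and4P[_ ->].
  have xy : x != y by apply: contraTneq (ltn_trans xc cy) => ->; rewrite ltnn.
  rewrite {}ER in Ra uw h132 h4312.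
  have ya : y < a by apply: (allP Ra); rewrite mem_cat yX.
  case: (sub2 _ _ c (Z ++ m :: S) _ _ xX yX xy) => sub.
    apply: (h132 x y c) => //; apply: subseq_trans (subseq_cons _ a).
    by rewrite -catA.
  by apply: (h4312 a y x c) => //; rewrite /= eqxx -catA.
apply: extremal_uniq => [|X c Z x y ES xX yX xc cy]; first by rewrite cat_cons.
case: X => [|m' X] in ES xX yX.
  case: ES => mc _; rewrite cats0 inE in yX.
  case/orP: yX => [/eqP|/(allP Ra) /=]; lia.
case: ES => mm' ES; subst m' S.
have am : a < m by [].
have Rm u : u \in R -> u < m by move/(allP Ra) => /=; lia.
have cX : c \notin a :: R ++ m :: X.
  move: uw; rewrite -cat_cons -cat_cons catA cat_uniq.
  by case/and3P=> _ /= /norP[].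
have subc u v : subseq [:: u; v] (a :: R ++ m :: X) ->
    subseq [:: u; v; c] (a :: R ++ m :: X ++ c :: Z).
  move=> sub; rewrite -cat_cons -cat_cons catA.
  by apply: (cat_subseq (s2 := [:: c]) sub); rewrite /= eqxx sub0seq.
have subam : subseq [:: m] (R ++ m :: X).
  by rewrite sub1seq mem_cat inE eqxx orbT.
have cna : c != a by apply: contraNneq cX => ->; rewrite inE eqxx.
have cnm : c != m by apply: contraNneq cX => ->; rewrite inE mem_cat inE eqxx !orbT.
(* If c < b, then a b x c is a 4312. Otherwise a 132 is given by b m c when b < c < a, by a m c when
   a < c < m, and by a y c when m < c. *)
have [cm|mc|cm] := ltngtP c m; last by rewrite cm eqxx in cnm.
  have [ca|ac|ca] := ltngtP c a; last by rewrite ca eqxx in cna.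
    clear ngtR uw yX; case: R => [//|b' R] in E R0 Ra Rm h4312 h132 cX subc subam xX *.
    case: E => bb' _; subst b'.
    have cb : c != b by apply: contraNneq cX => ->; rewrite !inE eqxx !orbT.
    have [cb'|bc|cb'] := ltngtP c b; last by rewrite cb' eqxx in cb.
      apply: (h4312 a b x c) => //; rewrite /= !eqxx.
      have : x \in R ++ m :: X.
        by move: xX; rewrite !inE => /or3P[/eqP|/eqP|//]; lia.
      rewrite -sub1seq => /cat_subseq; rewrite -(cat_cons m X) catA.
      by move/(_ [:: c] (c :: Z)); apply; rewrite /= eqxx sub0seq.
    apply: (h132 b m c) => //; apply: subc; apply: subseq_trans (subseq_cons _ a).
    by rewrite /= eqxx sub1seq mem_cat inE eqxx orbT.
  by apply: (h132 a m c) => //; apply: subc; rewrite /= eqxx.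
apply: (h132 a y c) => //; last by lia.
apply: subc; rewrite /= eqxx sub1seq.
by move: yX; rewrite inE => /orP[/eqP|//]; lia.
Qed.

(** * Reconstruction of a layered word from its ascents *)

(* Entries [lo], [lo] + 1, ... of a word, p of which precede v: the descents still
   to come take the smallest values, so the preceding entries form an interval
   just above those, and the next entry is put at one end of it. *)
Fixpoint fill lo p (v : seq bool) : seq nat :=
  if v is x :: v' then (lo + count negb v' + (if x then p else 0)) :: fill lo p.+1 v'
  else [::].

Lemma iotaSr l n : iota l n.+1 = rcons (iota l n) (l + n).
Proof. by rewrite -addn1 iotaD cats1. Qed.

Lemma perm_fill lo p v :
  perm_eq (iota (lo + count negb v) p ++ fill lo p v) (iota lo (p + size v)).
Proof.
elim: v p => [|x v IH] p /=; first by rewrite cats0 !addn0.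
rewrite addnS -addSn; apply: perm_trans (IH p.+1).
rewrite -cat_rcons perm_cat2r; case: x; first by rewrite (add0n (count _ _)) -iotaSr.
by rewrite addn0 perm_rcons (add1n (count _ _)) addnS.
Qed.

Lemma extremal_fill p q lo v :
    all (fun y => lo + count negb v <= y < lo + count negb v + q) p ->
  extremal p (fill lo q v).
Proof.
elim: v p q => //= x v IH p q /allP hp; apply/andP; split.
  apply/orP; case: x hp => hp; [left|right]; apply/allP => y /hp /=; lia.
apply: IH; rewrite all_rcons; apply/andP; split; first by case: x {hp}; lia.
by apply/allP => y /hp; case: x {hp} => /=; lia.
Qed.

Lemma pairmap_fill z q lo v :
    lo + count negb v <= z < lo + count negb v + q ->
  pairmap ltn z (fill lo q v) = v.
Proof.
elim: v z q => //= x v IH z q hz; congr cons; first by case: x hz => /=; lia.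
by apply: IH; case: x hz => /=; lia.
Qed.

Lemma perm_iota_max l n p x : perm_eq (rcons p x) (iota l n.+1) ->
  all (ltn^~ x) p -> x = l + n /\ perm_eq p (iota l n).
Proof.
move=> pe px; have mem := perm_mem pe.
have Ex : x = l + n.
  have := mem x; rewrite mem_rcons inE eqxx mem_iota /= => /esym xi.
  have := mem (l + n); rewrite mem_rcons inE mem_iota.
  have -> : (l <= l + n < l + n.+1) by lia.
  by case/orP=> [/eqP//|/(allP px)/=]; lia.
split=> //; move: pe; rewrite iotaSr -Ex perm_rcons perm_sym perm_rcons perm_cons.
by rewrite perm_sym.
Qed.

Lemma perm_iota_min l n p x : perm_eq (rcons p x) (iota l n.+1) ->
  all (ltn x) p -> x = l /\ perm_eq p (iota l.+1 n).
Proof.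
move=> pe px; have mem := perm_mem pe.
have Ex : x = l.
  have := mem x; rewrite mem_rcons inE eqxx mem_iota /= => /esym xi.
  have := mem l; rewrite mem_rcons inE mem_iota.
  have -> : (l <= l < l + n.+1) by lia.
  by case/orP=> [/eqP//|/(allP px)/=]; lia.
by split=> //; move: pe; rewrite perm_rcons /= -Ex perm_cons.
Qed.

(** S is peeled off from the right: when the entries up to some point form an interval, the last of
    them is extremal, hence one end of it, and its letter tells which. *)
Lemma extremal_eq_fill lo p S (v := pairmap ltn (last 0 p) S) :
    p != [::] -> extremal p S -> perm_eq (p ++ S) (iota lo (size p + size S)) ->
  S = fill lo (size p) v /\ perm_eq p (iota (lo + count negb v) (size p)).
Proof.
rewrite /v {v}; elim: S p => [|x S IH] p p0 /=; first by rewrite cats0 !addn0.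
case/andP=> extx extS pe.
have [|||ES] := IH (rcons p x); rewrite ?size_rcons //.
- by case: (p).
- by rewrite cat_rcons addSn -addnS.
rewrite last_rcons size_rcons in ES *; set v := pairmap _ _ _ in ES * => pe'.
case/orP: extx => px.
  have [Ex pe2] := perm_iota_max pe' px.
  have -> : last 0 p < x by rewrite last_ltn.
  rewrite (add0n (count _ _)); split=> //.
  by rewrite /= -Ex -ES.
have [Ex pe2] := perm_iota_min pe' px.
have -> : last 0 p < x = false.
  case: (p) p0 px => // y q _ /allP px; apply: negbTE; rewrite -leqNgt ltnW //.
  exact/px/mem_last.
by rewrite /= addn0 -Ex -ES (add1n (count _ _)) addnS.
Qed.

(** The descents of s take the values below [lo], R takes the m + 1 values from [lo] on, and a comes
    just above. The [false] before r stands for the first entry of R; with nothing before it, [fill]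
    gives the same value for either letter. *)
Definition build (r s : seq bool) : seq nat :=
  let m := size r in
  let lo := (count negb s).+1 in
  (lo + m.+1) :: fill lo 0 (false :: r) ++ fill 1 m.+2 s.

Lemma perm_build r s : perm_eq (build r s) (iota 1 (size r + size s).+2).
Proof.
rewrite /build; set lo := _.+1; set m := size r.
have := perm_fill 1 m.+2 s; rewrite -!addSn; apply: perm_trans.
rewrite add1n -/lo -cat_cons perm_cat2r -cat1s perm_catC cats1 iotaSr.
rewrite perm_rcons perm_sym perm_rcons perm_cons perm_sym.
exact: (perm_fill lo 0 (false :: r)).
Qed.

Lemma build_layered r s (R := fill (count negb s).+1 0 (false :: r))
    (S := fill 1 (size r).+2 s) : head false s ->
  [/\ layered ((count negb s).+1 + (size r).+1) R S, ascents R = r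
    & layer_ascents R S = s].
Proof.
move=> hs; set lo := (count negb s).+1 in R *; set m := size r in S *.
have Rlt : all (fun y => lo <= y < lo + m.+1) R.
  have := perm_fill lo 0 (false :: r); rewrite cat0s => /perm_all ->.
  by apply/allP=> y; rewrite mem_iota.
split.
- apply/and5P; split=> //.
  + by apply: sub_all Rlt => y /= /andP[].
  + by apply: extremal_fill.
  + by rewrite /S /lo; case: s hs {lo R S Rlt} => [|[] s] //= _; lia.
  + apply: extremal_fill; rewrite add1n -/lo /=; apply/andP; split; first by lia.
    by apply: sub_all Rlt => y /=; lia.
- by rewrite /R /= pairmap_fill //; lia.
rewrite /layer_ascents pairmap_fill // add1n -/lo.
have := allP Rlt (last 0 R); rewrite /R /= mem_last => /(_ isT); lia.
Qed.

Lemma layered_uniq a R S R' S' : layered a R S -> layered a R' S' ->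
  R ++ S = R' ++ S' -> R = R' /\ S = S'.
Proof.
wlog leRR' : R S R' S' / size R <= size R' => [th lay lay' E|].
  case/orP: (leq_total (size R) (size R')) => le; first exact: th.
  by have [-> ->] := th R' S' R S le lay' lay (esym E).
move=> /and5P[_ _ _ aS _] /and5P[_ R'a _ _ _] E.
have [[|y T] ER' ES] := eq_cat_split E leRR'; first by rewrite ER' cats0 ES.
have /(allP R'a) : y \in R' by rewrite ER' mem_cat inE eqxx orbT.
by move: aS; rewrite ES /=; lia.
Qed.

Lemma eq_build a R S n : layered a R S -> perm_eq (a :: R ++ S) (iota 1 n) ->
  a :: R ++ S = build (ascents R) (layer_ascents R S).
Proof.
case/and5P=> R0 Ra extR _ extS pe.
have En : n = (size R).+1 + size S.
  by rewrite -(size_iota 1 n) -(perm_size pe) /= size_cat.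
rewrite En in pe; have [ES peR] := @extremal_eq_fill 1 (a :: R) S isT extS pe.
have Els : pairmap ltn (last 0 (a :: R)) S = layer_ascents R S.
  by case: (R) R0.
rewrite Els in ES peR.
rewrite -perm_rcons in peR; have [Ea {}peR] := perm_iota_max peR Ra.
rewrite /build size_ascents prednK ?lt0n ?size_eq0 // -ES Ea add1n.
case: R R0 extR peR {ES Els Ra Ea extS pe En} => // b R _ extR peR.
have [] := @extremal_eq_fill _ [:: b] R isT extR peR.
rewrite /= => ER /perm_small_eq => /(_ isT)[Eb]; rewrite addn0 add1n in ER Eb *.
by rewrite -ER -Eb.
Qed.

(** * Enumeration of marked words and the ballot recursion *)

Fixpoint words t : seq (seq bool) :=
  if t is t'.+1 then map (cons true) (words t') ++ map (cons false) (words t')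
  else [:: [::]].

(** Words with a cutting point, listed by the first letter of the left part to match the recursion
    of [marked]. *)
Fixpoint cuts t : seq (seq bool * seq bool) :=
  if t is t'.+1 then
    [seq ([::], v) | v <- words t] ++ [seq (true :: c.1, c.2) | c <- cuts t'] ++
    [seq (false :: c.1, c.2) | c <- cuts t']
  else [:: ([::], [::])].

Lemma cutsS t : cuts t.+1 =
  [seq ([::], v) | v <- words t.+1] ++ [seq (true :: c.1, c.2) | c <- cuts t] ++
    [seq (false :: c.1, c.2) | c <- cuts t].
Proof. by []. Qed.

Lemma mem_words t v : (v \in words t) = (size v == t).
Proof.
elim: t v => [|t IH] v /=; first by rewrite inE size_eq0.
rewrite mem_cat; apply/orP/idP => [[] /mapP[u]|].
- by rewrite IH => + ->.
- by rewrite IH => + ->.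
by case: v => // -[] v; [left|right]; apply: map_f; rewrite IH.
Qed.

Lemma uniq_words t : uniq (words t).
Proof.
elim: t => //= t IH; rewrite cat_uniq !map_inj_uniq ?IH //=; try by move=> ? ? [].
by rewrite andbT; apply/hasPn=> _ /mapP[v _ ->]; apply/mapP=> -[].
Qed.

Lemma mem_cuts t c : (c \in cuts t) = (size c.1 + size c.2 == t).
Proof.
elim: t c => [|t IH] c; first by case: c => -[|? ?] [|? ?].
rewrite cutsS !mem_cat.
apply/or3P/idP => [[] /mapP[u]|].
- by rewrite mem_words => + ->.
- by rewrite IH => + -> /=; rewrite addSn.
- by rewrite IH => + -> /=; rewrite addSn.
case: c => -[|x r] s E.
  by constructor 1; apply/mapP; exists s; rewrite ?mem_words.
by case: x E => E; [constructor 2|constructor 3]; apply/mapP; exists (r, s); rewrite ?IH.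
Qed.

Lemma uniq_cuts t : uniq (cuts t).
Proof.
elim: t => // t IH.
rewrite cutsS !cat_uniq.
rewrite !map_inj_uniq ?IH ?uniq_words //; try by move=> [? ?] [? ?] /= [-> ->].
  rewrite !andTb andbT; apply/andP; split; apply/hasPn=> c.
    by rewrite mem_cat => /orP[] /mapP[d _ ->]; apply/mapP=> -[].
  by case/mapP=> d _ ->; apply/mapP=> -[].
by move=> ? ? [].
Qed.

Lemma count_negb_id v : count negb v + count id v = size v.
Proof. by elim: v => //= -[] v /=; lia. Qed.

Definition num_ballot t u := count (fun v => (count id v == u) && ballot v) (words t).

Definition num_marked t u :=
  count (fun c => (count id (c.1 ++ c.2) == u) && marked c.1 c.2) (cuts t).

Lemma count_none (T : eqType) (a : pred T) (s : seq T) :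
  {in s, forall x, a x = false} -> count a s = 0.
Proof. by move=> h; rewrite (eq_in_count h) count_pred0. Qed.

Lemma num_ballotS (t u : nat) :
  num_ballot t.+1 u =
    if t.+1 <= u.*2 then (if u is u'.+1 then num_ballot t u' else 0) + num_ballot t u
    else 0.
Proof.
have words_id v : v \in words t -> count negb v + count id v = t.
  by rewrite mem_words count_negb_id => /eqP.
rewrite /num_ballot [words _]/= count_cat !count_map; case: ifP => tu.
  congr (_ + _); last first.
    apply: eq_in_count => v /words_id Et /=; rewrite add0n.
    by case: eqP => //= Eu; rewrite (_ : _ <= _) //; lia.
  case: u tu => [|u] tu; first by rewrite count_none.
  apply: eq_in_count => v /words_id Et /=.
  rewrite add1n eqSS; case: eqP => //= Eu.
  by rewrite (_ : _ <= _) //; lia.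
rewrite !count_none // => v /words_id Et /=;
  by case: eqP => //= Eu; rewrite (_ : _ <= _ = false) //; lia.
Qed.

(** The first summand is the case of r empty, where s is an ascent followed by a ballot word; the
    second removes the first letter of r. *)
Lemma num_markedS (t u : nat) :
  num_marked t.+1 u =
    (if u is u'.+1 then num_ballot t u' else 0) +
    if t.+1 < u.*2 then (if u is u'.+1 then num_marked t u' else 0) + num_marked t u
    else 0.
Proof.
rewrite /num_marked cutsS !count_cat !count_map; congr (_ + _).
  rewrite [words _]/= count_cat !count_map addnC count_none ?add0n; last first.
    by move=> v _ /=; rewrite andbF.
  by case: u => [|u]; [apply: count_none => v _ | apply: eq_count => v].
have cuts_id (c : seq bool * seq bool) : c \in cuts t ->
    count negb (c.1 ++ c.2) + count id (c.1 ++ c.2) = t.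
  by rewrite mem_cuts count_negb_id size_cat => /eqP.
case: ifP => tu.
  congr (_ + _); last first.
    apply: eq_in_count => c /cuts_id Et /=; rewrite !add0n.
    by case: eqP => //= Eu; rewrite (_ : _ < _) //; lia.
  case: u tu => [|u] tu; first by rewrite count_none.
  apply: eq_in_count => c /cuts_id Et /=.
  rewrite add1n eqSS; case: eqP => //= Eu.
  by rewrite (_ : _ < _) //; lia.
by rewrite !count_none // => c /cuts_id Et /=;
  case: eqP => //= Eu; rewrite (_ : _ < _ = false) //; lia.
Qed.

(** The ballot number 'C(t, u) - 'C(t, u + 1), stated as a sum to avoid truncated subtraction. At
    the boundary t = 2 u + 1, which the recursion reaches, the count is 0 and the binomials agree by
    symmetry. *)
Lemma num_ballotE (t u : nat) : t <= u.*2.+1 -> num_ballot t u + 'C(t, u.+1) = 'C(t, u).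
Proof.
elim: t u => [|t IH] u tu; first by case: u {tu}.
rewrite num_ballotS; case: ifP => tu'.
  case: u => [//|u] in tu tu' *; rewrite !binS.
  have := IH u; have := IH u.+1; lia.
have -> : t = u.*2 by lia.
by rewrite add0n -bin_sub; [congr ('C(_, _))|]; lia.
Qed.

(** The factor truncates to 0 when marked words cannot exist, as they have more ascents than
    descents. Otherwise the ballot number evens out the coefficients of 'C(t, u) and 'C(t, u + 1),
    and Pascal's rule applies. *)
Lemma num_markedE (t u : nat) : num_marked t u = (u.*2 - t) * 'C(t, u).
Proof.
elim: t u => [|t IH] u; first by case: u => [|u]; rewrite ?bin0n ?muln0.
rewrite num_markedS; case: u => [//|u]; rewrite !IH binS; case: ifP => tu.
  have := @num_ballotE t u.
  have -> : u.+1.*2 - t.+1 = (u.*2 - t).+1 by lia.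
  have -> : u.+1.*2 - t = (u.*2 - t).+2 by lia.
  by nia.
have -> : u.+1.*2 - t.+1 = 0 by lia.
rewrite mul0n addn0; case: t tu {IH} => [|t] tu; first by lia.
by rewrite num_ballotS ifN //; lia.
Qed.

(** * From words to permutations, and the count *)

Lemma one_line_permP n w :
  reflect (exists p : 'S_n, w = one_line p) (perm_eq w (iota 1 n)).
Proof.
have one_lineE (p : 'S_n) : one_line p = [seq tnth (iota_tuple n 1) (p i) | i : 'I_n].
  by apply: eq_map => i; rewrite (tnth_nth 0) nth_iota.
apply: (iffP (@tuple_permP _ n w (iota_tuple n 1))) => -[p Ep].
  by exists p; rewrite Ep one_lineE.
by exists p; rewrite Ep one_lineE.
Qed.

Lemma one_line_inj n : injective (@one_line n).
Proof.
move=> p q /eq_in_map E; apply/permP => i; apply: val_inj.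
by have [] := E i (mem_enum _ i).
Qed.

Lemma perm_one_line n (p : 'S_n) : perm_eq (one_line p) (iota 1 n).
Proof. by apply/one_line_permP; exists p. Qed.

Lemma uniq_one_line n (p : 'S_n) : uniq (one_line p).
Proof. by rewrite (perm_uniq (perm_one_line p)) iota_uniq. Qed.

Lemma uniquely_sortedP n (p : 'S_n) :
  reflect (sortable (one_line p) /\ balanced (ascents (one_line p)))
          (p \in uniquely_sorted n).
Proof.
(* A preimage among all sequences rearranges 1, ..., n, so it is already a permutation. *)
have preimage q : stack_sort q = one_line p -> exists s : 'S_n, q = one_line s.
  move=> Eq; apply/one_line_permP; rewrite perm_sym.
  apply: perm_trans (perm_stack_sort q); rewrite Eq perm_sym.
  exact: perm_one_line.
rewrite inE; apply: (iffP cards1P) => [[q0 Eq0]|[sp bal]].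
  have q0P q : (stack_sort (one_line q) == one_line p) = (q == q0).
    by move/setP: Eq0 => /(_ q); rewrite !inE.
  have /eqP Ep : stack_sort (one_line q0) == one_line p by rewrite q0P.
  have sp : sortable (one_line p).
    by rewrite -Ep; apply/stack_sort_sortable/uniq_one_line.
  split=> //; apply: preimage_uniq_balanced => //; first exact: uniq_one_line.
  have toq0 q : stack_sort q = one_line p -> q = one_line q0.
    by move=> Eq; have [s Es] := preimage _ Eq; move/eqP: Eq; rewrite Es q0P => /eqP->.
  by move=> q q' /toq0-> /toq0->.
have [q Eq] := sortable_preimage sp; have [s Es] := preimage _ Eq; subst q.
exists s; apply/setP=> s'; rewrite !inE; apply/eqP/eqP => [Es'|->//].
by apply/one_line_inj/(balanced_preimage_uniq _ _ Es' Eq bal); apply: uniq_one_line.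
Qed.

Lemma card_one_line n (A : {set 'S_n}) (W : seq (seq nat)) :
  uniq W -> {in W, forall w, perm_eq w (iota 1 n)} ->
  (forall p, (p \in A) = (one_line p \in W)) -> #|A| = size W.
Proof.
move=> uW permW memW; rewrite cardE -(size_map (@one_line n)); apply: perm_size.
apply: uniq_perm => //; first by rewrite (map_inj_uniq (@one_line_inj n)) enum_uniq.
move=> w; apply/mapP/idP => [[p]|wW]; first by rewrite mem_enum memW => + ->.
have /one_line_permP[p Ep] := permW _ wW; exists p => //.
by rewrite mem_enum memW -Ep.
Qed.

(** The 2 k ascent letters without the descent leaving a, cut where S starts: k of the remaining 2 k
    - 1 are ascents. *)
Definition codes k : seq (seq bool * seq bool) :=
  [seq c <- cuts (2 * k - 1) | (count id (c.1 ++ c.2) == k) && marked c.1 c.2].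

Lemma size_codes k : 0 < k -> size (codes k) = 'C(2 * k - 1, k).
Proof.
move=> k0; rewrite size_filter -/(num_marked _ _) num_markedE.
have -> : k.*2 - (2 * k - 1) = 1 by lia.
exact: mul1n.
Qed.

Lemma marked_head r s : marked r s -> head false s.
Proof. by elim: r => [|x r IH] /=; [case: s => [|[]]|case/andP]. Qed.

Lemma build_inj k : {in codes k &, injective (fun c => build c.1 c.2)}.
Proof.
move=> [r s] [r' s']; rewrite !mem_filter /= => /andP[/andP[_ /marked_head hs] _].
move=> /andP[/andP[_ /marked_head hs'] _].
have [lay Er Es] := build_layered r hs; have [lay' Er' Es'] := build_layered r' hs'.
move=> E; have ERS := congr1 behead E; have {E} Ea := congr1 (head 0) E.
rewrite [X in layered X]Ea in lay.
have [ER ES] := layered_uniq lay lay' ERS.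
congr (_, _); first by rewrite -[LHS]Er -[RHS]Er' ER.
by rewrite -[LHS]Es -[RHS]Es' ER ES.
Qed.

Lemma perm_build_codes k c : 0 < k -> c \in codes k ->
  perm_eq (build c.1 c.2) (iota 1 (2 * k + 1)).
Proof.
move=> k0; rewrite mem_filter mem_cuts => /andP[_ /eqP sz].
have := perm_build c.1 c.2; rewrite sz.
by rewrite (_ : (2 * k - 1).+2 = 2 * k + 1) //; lia.
Qed.

Lemma mem_build_codes k (p : 'S_(2 * k + 1)) : 0 < k ->
  (p \in uniquely_sorted_avoiding (2 * k + 1) [:: [:: 1; 3; 2]; [:: 4; 3; 1; 2]])
    = (one_line p \in [seq build c.1 c.2 | c <- codes k]).
Proof.
move=> k0; rewrite inE /= andbT.
have szp := perm_size (perm_one_line p); rewrite size_iota in szp.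
apply/and3P/mapP => [[/uniquely_sortedP[sp bal] av132 av4312]|[[r s] cW Ep]].
  have up := uniq_one_line p; have permp := perm_one_line p.
  move Ew: (one_line p) => w in szp sp bal av132 av4312 up permp *.
  case: w => [|a [|b w]] in {Ew} szp sp bal av132 av4312 up permp *.
  - by rewrite addn1 in szp.
  - by move: szp => /=; lia.
  (* An ascent in front of a ballot word would leave a surplus, against balance. *)
  have ba : b < a.
    have := sortable_ballot sp; move: bal up; rewrite /balanced /= inE.
    case: (ltngtP a b) => //= ab.
    by move=> /eqP + _ /andP[_ /ballot_count]; lia.
  have lastw : all (leq^~ (last b w)) [:: a, b & w].
    by apply/allP=> y yw; apply: (sortable_last_max sp yw).
  have [R [S [E lay]]] := avoid_layered up ba lastw av132 av4312.
  rewrite E in szp sp bal permp *.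
  exists (ascents R, layer_ascents R S); last exact: eq_build lay permp.
  have szR : size R > 0 by case/and5P: lay; case: (R).
  have sz : size (ascents R ++ layer_ascents R S) = 2 * k - 1.
    move: szp; rewrite size_cat size_ascents size_pairmap /= size_cat; lia.
  rewrite mem_filter mem_cuts /= -size_cat sz eqxx andbT.
  rewrite (sortable_marked lay sp bal) andbT.
  move: bal; rewrite layered_ascents // /balanced /=.
  by have := count_negb_id (ascents R ++ layer_ascents R S); rewrite sz; lia.
move: (cW); rewrite mem_filter mem_cuts /= => /andP[/andP[/eqP cnt mark] /eqP sz].
have [lay ER ES] := build_layered r (marked_head mark).
have [av132 av4312] := layered_avoid lay.
have bal : balanced (ascents (build r s)).
  rewrite layered_ascents // ER ES /balanced /=.
  by have := count_negb_id (r ++ s); rewrite size_cat sz cnt; set m := count negb _; lia.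
rewrite Ep; split=> //; apply/uniquely_sortedP; rewrite Ep; split=> //.
by apply: marked_sortable; rewrite // ER ES.
Qed.

(* At k = 0 the truncated 2 * k - 1 is 0, and 'C(0, 0) = 1 is the value
   prescribed by the convention binom(-1, 0) = 1. *)
Theorem theorem4p1 (k : nat) :
  #|uniquely_sorted_avoiding (2 * k + 1) [:: [:: 1; 3; 2]; [:: 4; 3; 1; 2]]|
    = 'C(2 * k - 1, k).
Proof.
(* Built words have at least two letters, so the one-letter permutation for k = 0 is handled
   apart. *)
case: (posnP k) => [->|k0].
  rewrite muln0 (@card_one_line 1 _ [:: [:: 1]]) // => [w|p].
    by rewrite inE => /eqP->.
  have Ep : one_line p = [:: 1] by apply: perm_small_eq (perm_one_line p).
  rewrite !inE /= andbT Ep eqxx; apply/and3P; split.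
  - have /uniquely_sortedP : sortable (one_line p) /\ balanced (ascents (one_line p)).
      by rewrite Ep; split=> //; apply: sortable1.
    by rewrite inE Ep.
  - by apply/contains_132P => -[x [z [y [/size_subseq]]]].
  - by apply/contains_4312P => -[x [z [y [t [/size_subseq]]]]].
rewrite (card_one_line (W := [seq build c.1 c.2 | c <- codes k])).
- by rewrite size_map size_codes.
- by rewrite (map_inj_in_uniq (@build_inj k)) filter_uniq ?uniq_cuts.
- by move=> _ /mapP[c ck ->]; apply: perm_build_codes.
by move=> p; apply: mem_build_codes.
Qed.
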